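(* Assume that the parameters of the perturbed extrapolated hard thresholding algorithm (described in the context) satisfy $\gamma>\frac1h+(2\beta+h)L_f$. Let $\{x^k\}$ be a sequence generated by this algorithm, in which $\epsilon=0$ and $\sum_{k=0}^\infty\|e^k\|^2<\infty$. Then $$\sum_{k=0}^{\infty}\|x^{k+1}-x^k\|^2<+\infty .$$ Moreover, every $x^*\in\mathcal{X}:=\{\bar x\in\Omega: \exists\,\{x^{k_i}\}\subseteq\{x^k\}\text{ satisfying }\lim_{i\to\infty}x^{k_i}=\bar x\}$ is a local minimizer of the problem $\min_{x\in\Omega}F(x)$.
   Context: Problem: minimize $F(x)=f(x)+\lambda_1\|x_+\|_0+\lambda_2\|x_-\|_0$ over $x\in\Omega$, where $\lambda_1>0$, $\lambda_2\ge 0$, $f:\mathbb{R}^n\to\mathbb{R}$ is a convex function whose gradient is $L_f$-Lipschitz continuous, $\|x_+\|_0$ (resp. $\|x_-\|_0$) is the number of indices $i$ with $x_i>0$ (resp. $x_i<0$), and $\Omega=\{x\in\mathbb{R}^n: l_i\le x_i\le u_i,\ i=1,\dots,n\}$ with $-\infty\le l_i\le 0\le u_i\le+\infty$, $l_i<u_i$. $\|\cdot\|$ is the Euclidean norm, $\|\cdot\|_1$ the $\ell_1$ norm. A local minimizer is a point $x^*\in\Omega$ such that for some $\delta>0$, $F(x^* )\le F(x)$ for all $x\in\Omega$ with $\|x-x^*\|\le\delta$. Perturbed extrapolated hard thresholding algorithm: the parameters are $\epsilon\ge 0$, $\beta\ge 0$, $h>0$, $\gamma>0$ with $\gamma\ge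 \frac1h+(2\beta+h)L_f$; $\{e^k\}\subset\mathbb{R}^n$ is a sequence of (unknown) error terms; the initial points are $x^{-1}=x^0\in\Omega$. For $k=0,1,2,\dots$ compute $$v^k=\frac{1}{h(1+h\gamma)}(x^k-x^{k-1})-\frac{\beta}{1+h\gamma}\big(\nabla f(x^k)-\nabla f(x^{k-1})\big),\qquad z^k=v^k-\frac{h}{1+h\gamma}\big(\nabla f(x^k)-e^k\big),$$ and choose $$x^{k+1}\in x^k+h\cdot\arg\min_{y\in\Omega^k}Q(x^k,z^k,y),$$ where $\Omega^k=\{y\in\mathbb{R}^n: \frac{l_i-x^k_i}{h}\le y_i\le\frac{u_i-x^k_i}{h},\ i=1,\dots,n\}$ and $$Q(x,z,y)=\frac{h\epsilon}{1+h\gamma}\|y\|_1+\frac{\lambda_1}{1+h\gamma}\|(x+hy)_+\|_0+\frac{\lambda_2}{1+h\gamma}\|(x+hy)_-\|_0+\frac12\|y-z\|^2 .$$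
   Formalization: The summability of ‖x^{k+1}−x^k‖² is proved under the added assumption that F is bounded below on Ω; without it the claim fails, e.g. for f(x) = −x on Ω = ℝ. The local-minimizer claim needs no such assumption. *)

(* Defs.v *)
From HB Require Import structures.
From mathcomp Require Import all_boot all_order all_algebra.
From mathcomp Require Import all_classical all_reals all_analysis.

Set Implicit Arguments.
Unset Strict Implicit.
Unset Printing Implicit Defensive.

Import Order.TTheory GRing.Theory Num.Theory.
Import numFieldNormedType.Exports.

Local Open Scope classical_set_scope.
Local Open Scope ring_scope.

(* The library norm `|x| on row vectors is the sup norm; [norm1] and [norm2]
   are the l1 and Euclidean norms.  All these norms are equivalent, so the
   library notions of limit and of Frechet differentiability on 'rV[R]_n are
   the Euclidean ones. *)
Definition norm1 (R : realType) (n : nat) (x : 'rV[R]_n) : R :=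
  \sum_(i < n) `|x 0 i|.

Definition norm2 (R : realType) (n : nat) (x : 'rV[R]_n) : R :=
  Num.sqrt (\sum_(i < n) x 0 i ^+ 2).

Definition gradient (R : realType) (n : nat) (f : 'rV[R]_n -> R)
    (x : 'rV[R]_n) : 'rV[R]_n :=
  \row_(i < n) 'D_(delta_mx 0 i) f x.

Definition lipschitz_gradient (R : realType) (n : nat) (f : 'rV[R]_n -> R)
    (L : R) : Prop :=
  (forall x, differentiable f x) /\
  (forall x y, norm2 (gradient f x - gradient f y) <= L * norm2 (x - y)).

(* ||x_+||_0 and ||x_-||_0 *)
Definition l0_pos (R : realType) (n : nat) (x : 'rV[R]_n) : R :=
  #|[pred i : 'I_n | 0 < x 0 i]|%:R.

Definition l0_neg (R : realType) (n : nat) (x : 'rV[R]_n) : R :=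
  #|[pred i : 'I_n | x 0 i < 0]|%:R.

Definition objective (R : realType) (n : nat) (f : 'rV[R]_n -> R)
    (lambda1 lambda2 : R) (x : 'rV[R]_n) : R :=
  f x + lambda1 * l0_pos x + lambda2 * l0_neg x.

Definition box (R : realType) (n : nat) (l u : 'I_n -> \bar R) :
    set 'rV[R]_n :=
  [set x : 'rV[R]_n | forall i, (l i <= (x 0 i)%:E <= u i)%E].

Definition local_minimizer (R : realType) (n : nat) (F : 'rV[R]_n -> R)
    (A : set 'rV[R]_n) (xs : 'rV[R]_n) : Prop :=
  A xs /\ exists2 delta : R, 0 < delta &
    forall x, A x -> norm2 (x - xs) <= delta -> F xs <= F x.

Definition argmin_set (R : realType) (T : Type) (A : set T) (g : T -> R) :
    set T :=
  [set y : T | A y /\ forall y', A y' -> g y <= g y'].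

(* The points xbar of A that are limits of subsequences of x *)
Definition subseq_limits (R : realType) (n : nat) (A : set 'rV[R]_n)
    (x : nat -> 'rV[R]_n) : set 'rV[R]_n :=
  [set xbar : 'rV[R]_n | A xbar /\
    exists2 s : nat -> nat, increasing_seq s & x \o s @ \oo --> xbar].

(* Omega^k, at the current point x = x^k *)
Definition step_box (R : realType) (n : nat) (l u : 'I_n -> \bar R) (h : R)
    (x : 'rV[R]_n) : set 'rV[R]_n :=
  [set y : 'rV[R]_n | forall i, ((l i - (x 0 i)%:E) * (h^-1)%:E <= (y 0 i)%:E
                                 <= (u i - (x 0 i)%:E) * (h^-1)%:E)%E].

Definition eht_Q (R : realType) (n : nat) (lambda1 lambda2 eps h gamma : R)
    (x z y : 'rV[R]_n) : R :=
  h * eps / (1 + h * gamma) * norm1 y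
  + lambda1 / (1 + h * gamma) * l0_pos (x + h *: y)
  + lambda2 / (1 + h * gamma) * l0_neg (x + h *: y)
  + 2^-1 * norm2 (y - z) ^+ 2.

(* x k.-1 stands for x^{k-1}; at k = 0 it is x 0, which is the convention
   x^{-1} = x^0. *)
Definition eht_v (R : realType) (n : nat) (f : 'rV[R]_n -> R)
    (beta h gamma : R) (x : nat -> 'rV[R]_n) (k : nat) : 'rV[R]_n :=
  (h * (1 + h * gamma))^-1 *: (x k - x k.-1)
  - (beta / (1 + h * gamma)) *: (gradient f (x k) - gradient f (x k.-1)).

Definition eht_z (R : realType) (n : nat) (f : 'rV[R]_n -> R)
    (beta h gamma : R) (e x : nat -> 'rV[R]_n) (k : nat) : 'rV[R]_n :=
  eht_v f beta h gamma x k
  - (h / (1 + h * gamma)) *: (gradient f (x k) - e k).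

(* x is a sequence generated by the perturbed extrapolated hard thresholding
   algorithm with error terms e. *)
Definition perturbed_eht (R : realType) (n : nat) (f : 'rV[R]_n -> R)
    (l u : 'I_n -> \bar R) (lambda1 lambda2 eps beta h gamma : R)
    (e x : nat -> 'rV[R]_n) : Prop :=
  box l u (x 0%N) /\
  forall k : nat,
    [set x k + h *: y | y in argmin_set (step_box l u h (x k))
       (eht_Q lambda1 lambda2 eps h gamma (x k)
          (eht_z f beta h gamma e x k))] (x k.+1).

(* Main.v *)
Require Import Defs.
From HB Require Import structures.
From mathcomp Require Import all_boot all_order all_algebra.
From mathcomp Require Import all_classical all_reals all_analysis.
From mathcomp Require Import ring lra.

Set Implicit Arguments.
Unset Strict Implicit.
Unset Printing Implicit Defensive.

Import Order.TTheory GRing.Theory Num.Theory.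
Import numFieldNormedType.Exports.

Local Open Scope classical_set_scope.
Local Open Scope ring_scope.

(** Write $g_k$ for the gradient of $f$ at $x^k$ and $d_k = x^k - x^{k-1}$.
    Up to a positive factor and a constant, the subproblem solved at step $k$
    is, in the variable $w = x^k + h y$ ranging over the box,
    $$ \sum_i \varphi(w_i) + \frac A2 \|w - x^k\|^2
       + \langle w - x^k, q_k \rangle, \qquad
       A = \frac1{h^2} + \frac\gamma h, \qquad
       q_k = g_k - e^k + \frac\beta h (g_k - g_{k-1}) - \frac1{h^2} d_k, $$
    where $\varphi$ is the scalar penalty [sign_cost].  Both the objective and
    the box are separable, so $x^{k+1}$ is optimal in each coordinate
    separately ([eht_coord_min]).  The two claims both come from this
    coordinatewise optimality.

    Summability.  Testing each coordinate against $w_i = x^k_i$ and adding the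
    descent inequality for $f$ bounds $F(x^{k+1}) - F(x^k)$.  The three inner
    products of $d_{k+1}$ with $e^k$, $g_k - g_{k-1}$ and $d_k$ are split by
    Young's inequality; the condition on $\gamma$ says exactly that the
    coefficient obtained for $\|d_{k+1}\|^2$ exceeds the one obtained for
    $\|d_k\|^2$.  Hence $F(x^k) + c \|d_k\|^2$ decreases by a multiple of
    $\|d_{k+1}\|^2$, up to a multiple of $\|e^k\|^2$ ([eht_energy_step]).
    Telescoping bounds the partial sums of $\|d_k\|^2$ as soon as $F(x^k)$ is
    bounded below for arbitrarily large $k$ ([eht_steps_summable]).  This
    weak form of the bound matters: it is given by the lower bound of $F$ in
    the first claim, but also by the mere existence of a convergent
    subsequence in the second one.

    Local minimality.  Along a subsequence converging to $\bar x$ one has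
    $d_{k+1} \to 0$ and $q_k \to \nabla f(\bar x)$.  Since $\varphi$ is lower
    semicontinuous, coordinatewise optimality passes to the limit: $\bar x$
    minimizes its own proximal subproblem ([eht_limit_coord_min]).  The
    quadratic term of that subproblem is of second order, and $\varphi$ is
    either constant on the segment from $\bar x_i$ to a nearby point or jumps
    up by a fixed amount, so that
    $$ \varphi(\bar x_i) \le \varphi(b)
       + (b - \bar x_i)\, \partial_i f(\bar x) $$
    for $b$ near $\bar x_i$ ([sign_cost_local_min]).  Adding these
    inequalities to the gradient inequality of the convex $f$ concludes. *)

(** * Euclidean inner product and norm *)

Section EuclideanSpace.
Context (R : realType) (n : nat).
Implicit Types (u v w x y : 'rV[R]_n) (c : R).

Definition dot u v : R := \sum_(i < n) u 0 i * v 0 i.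

Lemma norm2_ge0 u : 0 <= norm2 u.
Proof. exact: sqrtr_ge0. Qed.

Lemma sqr_norm2 u : norm2 u ^+ 2 = \sum_(i < n) u 0 i ^+ 2.
Proof. by rewrite sqr_sqrtr// sumr_ge0// => i _; exact: sqr_ge0. Qed.

Lemma norm2_eq0 u : norm2 u = 0 -> u = 0.
Proof.
move=> u0; apply/rowP => i; rewrite mxE; apply/eqP; rewrite -sqrf_eq0.
have /eqP : \sum_(i < n) u 0 i ^+ 2 = 0 by rewrite -sqr_norm2 u0 expr0n.
rewrite psumr_eq0; last by move=> j _; exact: sqr_ge0.
by move/allP => /(_ i); apply; rewrite mem_index_enum.
Qed.

Lemma norm2N u : norm2 (- u) = norm2 u.
Proof.
by rewrite /norm2; congr Num.sqrt; apply: eq_bigr => i _; rewrite mxE sqrrN.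
Qed.

Lemma norm2Z c u : 0 <= c -> norm2 (c *: u) = c * norm2 u.
Proof.
move=> c0; apply/eqP; rewrite -(eqrXn2 (ltn0Sn 1)) ?mulr_ge0 ?norm2_ge0//.
rewrite exprMn !sqr_norm2 mulr_sumr.
by apply/eqP; apply: eq_bigr => i _; rewrite mxE exprMn.
Qed.

Lemma coord_le_norm2 u i : `|u 0 i| <= norm2 u.
Proof.
rewrite -sqrtr_sqr; apply: ler_wsqrtr.
by rewrite (bigD1 i)//= lerDl sumr_ge0// => j _; exact: sqr_ge0.
Qed.

Lemma dotDr u v w : dot u (v + w) = dot u v + dot u w.
Proof. by rewrite -big_split/=; apply: eq_bigr => i _; rewrite mxE mulrDr. Qed.

Lemma dotZr u c v : dot u (c *: v) = c * dot u v.
Proof. by rewrite mulr_sumr; apply: eq_bigr => i _; rewrite mxE mulrCA. Qed.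

Lemma dotNr u v : dot u (- v) = - dot u v.
Proof. by rewrite -scaleN1r dotZr mulN1r. Qed.

Lemma dotC u v : dot u v = dot v u.
Proof. by apply: eq_bigr => i _; rewrite mulrC. Qed.

Lemma dot0r u : dot u 0 = 0.
Proof. by rewrite /dot big1// => i _; rewrite mxE mulr0. Qed.

Lemma dot_le_norm2 u v : dot u v <= norm2 u * norm2 v.
Proof.
have [/norm2_eq0 ->|u0] := eqVneq (norm2 u) 0.
  by rewrite dotC dot0r mulr_ge0 ?norm2_ge0.
have [/norm2_eq0 ->|v0] := eqVneq (norm2 v) 0.
  by rewrite dot0r mulr_ge0 ?norm2_ge0.
set a := norm2 u; set b := norm2 v.
have a0 : 0 < a by rewrite lt_neqAle eq_sym u0 norm2_ge0.
have b0 : 0 < b by rewrite lt_neqAle eq_sym v0 norm2_ge0.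
(* Expanding the square of the norm of b u - a v leaves 2ab (ab - <u, v>). *)
have : 0 <= \sum_(i < n) (b * u 0 i - a * v 0 i) ^+ 2.
  by apply: sumr_ge0 => i _; exact: sqr_ge0.
have -> : \sum_(i < n) (b * u 0 i - a * v 0 i) ^+ 2 =
    2 * (a * b) * (a * b - dot u v).
  transitivity (b ^+ 2 * a ^+ 2 + a ^+ 2 * b ^+ 2 - 2 * (a * b) * dot u v).
    rewrite [X in b ^+ 2 * X]sqr_norm2 [X in a ^+ 2 * X]sqr_norm2 /dot.
    rewrite !mulr_sumr.
    by rewrite -sumrN -!big_split/=; apply: eq_bigr => i _; ring.
  ring.
by rewrite pmulr_rge0 ?mulr_gt0// subr_ge0.
Qed.

Lemma young_dot c u v : 0 < c ->
  dot u v <= c / 2 * norm2 u ^+ 2 + norm2 v ^+ 2 / (2 * c).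
Proof.
move=> c0; apply: (le_trans (dot_le_norm2 u v)).
rewrite -subr_ge0.
have -> : c / 2 * norm2 u ^+ 2 + norm2 v ^+ 2 / (2 * c) - norm2 u * norm2 v =
    (c * norm2 u - norm2 v) ^+ 2 / (2 * c).
  by field; rewrite gt_eqF.
by rewrite divr_ge0 ?sqr_ge0// mulr_ge0// ltW.
Qed.

(** Convergence for the canonical topology of row vectors, which is that of
    the sup norm, is convergence in Euclidean norm; [cvg_coord_norm2] below
    goes back to the coordinates. *)
Lemma cvg_norm2_sub (T : Type) (F : set_system T) {FF : Filter F}
    (g : T -> 'rV[R]_n) u :
  g @ F --> u -> norm2 (g t - u) @[t --> F] --> 0.
Proof.
move=> gu; rewrite -(sqrtr0 R).
apply: (@continuous_cvg _ _ _ _ _ _ Num.sqrt); first exact: sqrt_continuous.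
have sum0 : \sum_(i < n) (0 : R) = 0 by rewrite big1.
rewrite -[X in _ --> X]sum0.
apply: (@cvg_big _ _ _ _ _ _ _ _ _ (fun i t => (g t - u) 0 i ^+ 2) (fun=> 0)).
  exact: add_continuous.
move=> i _ /=.
have -> : (0 : R) = (u 0 i - u 0 i) ^+ 2 by rewrite subrr expr0n.
have gi : g t 0 i @[t --> F] --> u 0 i.
  apply: (@continuous_cvg _ _ _ _ _ _ (fun w : 'rV[R]_n => w 0 i)) => //.
  exact: coord_continuous.
under eq_fun do rewrite 2!mxE expr2.
by rewrite expr2; apply: cvgM; apply: cvgB => //; exact: cvg_cst.
Qed.

Lemma cvg_coord_norm2 (T : Type) (F : set_system T) {FF : Filter F}
    (g : T -> 'rV[R]_n) u i :
  norm2 (g t - u) @[t --> F] --> 0 -> g t 0 i @[t --> F] --> u 0 i.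
Proof.
move=> gu; apply/cvgrPdist_le => eps eps0.
have /cvgr0Pnorm_le /(_ _ eps0) := gu; apply: filterS => t.
rewrite ger0_norm ?norm2_ge0// => le_eps; rewrite distrC (le_trans _ le_eps)//.
by have := coord_le_norm2 (g t - u) i; rewrite !mxE.
Qed.

Lemma cvg_coord_norm2_0 (T : Type) (F : set_system T) {FF : Filter F}
    (g : T -> 'rV[R]_n) i :
  norm2 (g t) @[t --> F] --> 0 -> g t 0 i @[t --> F] --> 0.
Proof.
move=> g0; have : norm2 (g t - 0) @[t --> F] --> 0.
  by under eq_fun do rewrite subr0.
by move=> /cvg_coord_norm2 => /(_ i); rewrite mxE.
Qed.

End EuclideanSpace.

(** * Convex functions with Lipschitz gradient *)

Section SmoothFunctions.
Context (R : realType) (n : nat).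
Implicit Types (f : 'rV[R]_n -> R) (d x y : 'rV[R]_n) (L : R).

Lemma derive_gradient f x d : differentiable f x ->
  'D_d f x = dot (gradient f x) d.
Proof.
move=> fx; rewrite deriveE// [in LHS](row_sum_delta d) linear_sum/=.
by apply: eq_bigr => i _; rewrite linearZ/= mxE deriveE// mulrC.
Qed.

Lemma is_derive_line f x d (t : R) : differentiable f (t *: d + x) ->
  is_derive t 1 (fun s => f (s *: d + x)) (dot (gradient f (t *: d + x)) d).
Proof.
move=> fx; have fd := @diff_derivable _ _ _ _ _ d fx.
have E : (fun h : R => h^-1 *: (((fun s => f (s *: d + x)) \o shift t) (h *: 1)
      - f (t *: d + x))) =
    (fun h => h^-1 *: ((f \o shift (t *: d + x)) (h *: d) - f (t *: d + x))).
  by apply/funext => h /=; rewrite [h *: 1]mulr1 scalerDl addrA.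
by apply: DeriveDef; rewrite /derivable /derive E//; exact: derive_gradient.
Qed.

(** Along the segment from x to y the difference quotient of f at x is at
    most f y - f x by convexity; the derivative is its limit from the right. *)
Lemma convex_ge_tangent f x y : convex_function setT f ->
  differentiable f x -> f x + dot (gradient f x) (y - x) <= f y.
Proof.
move=> fconv fx; rewrite addrC -lerBrDr -derive_gradient//.
have fd := @diff_derivable _ _ _ _ _ (y - x) fx.
apply: (cvgr_to_le (cvg_dnbhs_at_right fd)).
near=> t.
have t0 : 0 < t by [].
have t1 : t < 1 by near: t; exact: nbhs_right_lt.
have t01 : Itv.spec (@Itv.num_sem R) (Itv.Real `[0, 1]%Z) t.
  by apply/and3P; split; rewrite ?num_real// bnd_simp ltW.
have := fconv (Itv.mk t01) y x (mem_set I) (mem_set I).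
rewrite /conv/= => ft; rewrite /= ler_pdivrMl//.
have -> : t *: (y - x) + x = t *: y + (1 - t) *: x.
  by rewrite scalerBr scalerBl scale1r addrA addrAC.
have {}ft : f (t *: y + (1 - t) *: x) <= t * f y + (1 - t) * f x := ft.
lra.
Unshelve. all: by end_near. Qed.

(** The gap between f and its quadratic upper model is nonincreasing along the
    segment from x to y: its derivative at t is the inner product of y - x
    with the variation of the gradient over a distance t |y - x|, minus
    L t |y - x|^2.  The mean value theorem then gives the constant L / 2
    for which the condition on gamma is calibrated. *)
Lemma lipschitz_gradient_le_quadratic f L x y : lipschitz_gradient f L ->
  f y <= f x + dot (gradient f x) (y - x) + L / 2 * norm2 (y - x) ^+ 2.
Proof.
move=> [fdiff flip]; set d := y - x; set g := gradient f x.
pose c := L / 2 * norm2 d ^+ 2.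
pose psi (t : R) := f (t *: d + x) - (t * dot g d + t ^+ 2 * c).
pose dpsi (t : R) := dot (gradient f (t *: d + x)) d - (dot g d + 2 * t * c).
have psi' (t : R) : is_derive t 1 psi (dpsi t).
  apply: is_deriveB; first exact: is_derive_line.
  have did : is_derive t (1 : R) (id : R -> R) 1 by exact: is_derive_id.
  have dcst b : is_derive t (1 : R) (cst b : R -> R) 0 by exact: is_derive_cst.
  have := is_deriveD (is_deriveM did (dcst (dot g d)))
    (is_deriveM (is_deriveX 2 did) (dcst c)).
  move=> /is_derive_eq; apply.
  rewrite /GRing.scale/=; ring.
have cpsi : {within `[0, 1], continuous psi}.
  by apply: derivable_within_continuous => t _; exact: ex_derive.
have [t] := MVT ltr01 (fun t _ => psi' t) cpsi.
rewrite in_itv/= => /andP[t0 t1].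
rewrite subr0 mulr1 /psi scale0r add0r scale1r subrK.
suff : dpsi t <= 0 by rewrite /c; lra.
have := dot_le_norm2 (gradient f (t *: d + x) - g) d.
rewrite dotC dotDr dotNr !(dotC d) => le1.
have := flip (t *: d + x) x; rewrite addrK norm2Z ?(ltW t0)// => le2.
have := ler_wpM2r (norm2_ge0 d) le2; rewrite /dpsi /c; lra.
Qed.

End SmoothFunctions.

(** * The scalar penalty and its local minimizers *)

Section SignCost.
Context (R : realType) (lambda1 lambda2 : R).
Hypotheses (lambda1_gt0 : 0 < lambda1) (lambda2_ge0 : 0 <= lambda2).

Definition sign_cost (t : R) : R :=
  if 0 < t then lambda1 else if t < 0 then lambda2 else 0.

Local Notation phi := sign_cost.

Lemma sign_cost_pos t : 0 < t -> phi t = lambda1.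
Proof. by rewrite /phi => ->. Qed.

Lemma sign_cost_neg t : t < 0 -> phi t = lambda2.
Proof. by move=> t0; rewrite /phi t0 ltNge (ltW t0). Qed.

Lemma sign_cost0 : phi 0 = 0.
Proof. by rewrite /phi ltxx. Qed.

Lemma sign_cost_ge0 t : 0 <= phi t.
Proof. by rewrite /phi; case: ifP => _; [exact: ltW|case: ifP]. Qed.

Lemma sign_cost_lsc a : \forall t \near a, phi a <= phi t.
Proof.
have [a0|a0|<-] := ltgtP 0 a.
- near=> t; rewrite !sign_cost_pos//; near: t; exact: lt_nbhsr.
- near=> t; rewrite !sign_cost_neg//; near: t; exact: lt_nbhsl.
- by near=> t; rewrite sign_cost0 sign_cost_ge0.
Unshelve. all: by end_near. Qed.

(** Divide by s and let s tend to 0.  If q < 0, an explicit s with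
    s |p| <= - q / 2 already gives a contradiction. *)
Lemma slope_ge0 (p q : R) :
  (forall s, 0 < s -> s <= 1 -> 0 <= s ^+ 2 * p + s * q) -> 0 <= q.
Proof.
move=> pq; rewrite leNgt; apply/negP => q0.
have p0 : 0 <= `|p| by [].
have d0 : 0 < 2 * (`|p| - q) by lra.
pose s := - q / (2 * (`|p| - q)).
have s0 : 0 < s by rewrite divr_gt0// oppr_gt0.
have s1 : s <= 1 by rewrite ler_pdivrMr// mul1r; lra.
have := pq s s0 s1; rewrite expr2 -mulrA -mulrDr pmulr_rge0// leNgt => /negP.
apply.
have sp : s * p <= s * `|p| by rewrite ler_pM2l// ler_norm.
have sd : s * (2 * (`|p| - q)) = - q by rewrite /s divfK// gt_eqF.
nra.
Qed.

Lemma ereal_segment (l u : \bar R) (a b s : R) :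
  (l <= a%:E <= u)%E -> (l <= b%:E <= u)%E -> 0 < s -> s <= 1 ->
  (l <= (a + s * (b - a))%:E <= u)%E.
Proof.
move=> /andP[la au] /andP[lb bu] s0 s1; apply/andP; split.
- have [ab|ba] := leP a b.
    by apply: (le_trans la); rewrite lee_fin lerDl; nra.
  by apply: (le_trans lb); rewrite lee_fin; nra.
- have [ab|ba] := leP a b.
    by apply: le_trans bu; rewrite lee_fin; nra.
  by apply: le_trans au; rewrite lee_fin; nra.
Qed.

(** The point [a] minimizes the penalty plus the linear term and a quadratic
    term; near [a] the quadratic term can be dropped.  If the penalty is
    constant on the segment from [a] to [b], moving from [a] towards
    [b] by a fraction s makes the quadratic term O(s^2), so the linear term is
    nonnegative.  Otherwise a = 0 and the penalty jumps up by lambda1 or by a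
    positive lambda2, which beats the linear term for [b] close to 0.  When
    lambda2 = 0 there is no jump on the negative side, and that side falls
    under the first case. *)
Lemma sign_cost_local_min (l u : \bar R) (A a g : R) :
  (l <= a%:E <= u)%E ->
  (forall b : R, (l <= b%:E <= u)%E ->
    phi a <= phi b + A * (b - a) ^+ 2 + (b - a) * g) ->
  exists2 delta : R, 0 < delta & forall b : R, (l <= b%:E <= u)%E ->
    `|b - a| <= delta -> phi a <= phi b + (b - a) * g.
Proof.
move=> lau prox.
have first_order b : (l <= b%:E <= u)%E ->
    (forall s, 0 < s -> s <= 1 -> phi (a + s * (b - a)) = phi a) ->
    0 <= (b - a) * g.
  move=> lbu phiE; apply: (@slope_ge0 (A * (b - a) ^+ 2)) => s s0 s1.
  have := prox _ (ereal_segment lau lbu s0 s1); rewrite phiE//.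
  have -> : a + s * (b - a) - a = s * (b - a) by ring.
  by move=> ?; lra.
have same_side b : (l <= b%:E <= u)%E ->
    (forall s, 0 < s -> s <= 1 -> phi (a + s * (b - a)) = phi a) ->
    phi a <= phi b + (b - a) * g.
  move=> lbu phiE; rewrite -(phiE 1)// mul1r addrC subrK lerDl.
  exact: first_order.
have [a0|a0|a0] := ltgtP 0 a.
- exists (a / 2); first by rewrite divr_gt0.
  move=> b lbu; rewrite ler_norml => /andP[ba _].
  apply: same_side => // s s0 s1.
  by rewrite !sign_cost_pos//; nra.
- exists (- a / 2); first by rewrite divr_gt0// oppr_gt0.
  move=> b lbu; rewrite ler_norml => /andP[_ ba].
  apply: same_side => // s s0 s1.
  by rewrite !sign_cost_neg//; nra.
(* m is the smallest positive jump of the penalty at 0. *)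
- pose m := if 0 < lambda2 then Num.min lambda1 lambda2 else lambda1.
  have m0 : 0 < m by rewrite /m; case: ifP => // l2; rewrite lt_min lambda1_gt0.
  have g0 : 0 < 1 + `|g| by rewrite ltr_pwDl.
  exists (m / (1 + `|g|)); first by rewrite divr_gt0.
  move=> b lbu; rewrite -a0 subr0 sign_cost0 => bm.
  have bg : - m <= b * g.
    have : `|b * g| <= m.
      rewrite normrM (le_trans (ler_wpM2r _ bm))// mulrAC ler_pdivrMr//.
      by rewrite ler_pM2l// lerDr.
    by rewrite ler_norml => /andP[].
  have [b0|b0|<-] := ltgtP 0 b.
  + have : m <= lambda1 by rewrite /m; case: ifP => // _; rewrite ge_min lexx.
    by rewrite sign_cost_pos//; move: bg; lra.
  + have [l20|l20] := ltP 0 lambda2.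
      have : m <= lambda2 by rewrite /m l20 ge_min lexx orbT.
      by rewrite sign_cost_neg//; move: bg; lra.
    have l2E : lambda2 = 0 by apply/le_anti; rewrite l20.
    rewrite -sign_cost0 a0 -[b in b * g]subr0 [in b - 0]a0.
    apply: same_side => // s s0 s1.
    by rewrite -a0 subr0 add0r sign_cost0 sign_cost_neg// pmulr_rlt0.
  + by rewrite sign_cost0 mul0r addr0.
Qed.

End SignCost.

(** * The subproblem is separable *)

Section Penalty.
Context (R : realType) (n : nat) (lambda1 lambda2 : R).
Implicit Types (x y : 'rV[R]_n) (h : R) (l u : 'I_n -> \bar R).

Lemma l0_penaltyE x : lambda1 * l0_pos x + lambda2 * l0_neg x =
  \sum_(i < n) sign_cost lambda1 lambda2 (x 0 i).
Proof.
have cardE (P : pred 'I_n) : #|P|%:R = \sum_(i < n) (P i : nat)%:R :> R.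
  rewrite -sum1_card natr_sum big_mkcond/=; apply: eq_bigr => i _.
  by rewrite -topredE/=; case: (P i).
rewrite /l0_pos /l0_neg !cardE !mulr_sumr -big_split/=.
apply: eq_bigr => i _; rewrite /sign_cost.
by case: ltgtP => _; rewrite ?mulr1 ?mulr0 ?addr0 ?add0r.
Qed.

Lemma objectiveE f x : objective f lambda1 lambda2 x =
  f x + \sum_(i < n) sign_cost lambda1 lambda2 (x 0 i).
Proof. by rewrite /objective -addrA l0_penaltyE. Qed.

Lemma step_boxP l u h x y : 0 < h ->
  step_box l u h x y <-> box l u (x + h *: y).
Proof.
move=> h0; have E i : ((l i - (x 0 i)%:E) * (h^-1)%:E <= (y 0 i)%:E
      <= (u i - (x 0 i)%:E) * (h^-1)%:E)%E =
    (l i <= ((x + h *: y) 0 i)%:E <= u i)%E.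
  rewrite lee_pdivrMr// lee_pdivlMr// leeBlDr// leeBrDr// -EFinM -EFinD !mxE.
  by rewrite (mulrC h) (addrC (x 0 i)).
by split => H i; have := H i; rewrite E.
Qed.

Lemma separable_argmin (A : set 'rV[R]_n) (g : 'I_n -> R -> R) y i b :
  argmin_set A (fun y => \sum_(i < n) g i (y 0 i)) y ->
  A (\row_j if j == i then b else y 0 j) -> g i (y 0 i) <= g i b.
Proof.
move=> [_ ymin] /ymin; rewrite (bigD1 i)// [leRHS](bigD1 i)//= mxE eqxx.
pose y' := \row_j (if j == i then b else y 0 j).
rewrite [X in _ + X <= _](eq_bigr (fun j => g j (y' 0 j))) ?lerD2r//.
by move=> j ji; rewrite mxE (negbTE ji).
Qed.

Lemma eht_QE h gamma x z y :
  eht_Q lambda1 lambda2 0 h gamma x z y = \sum_(i < n)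
    (sign_cost lambda1 lambda2 (x 0 i + h * y 0 i) / (1 + h * gamma)
     + 2^-1 * (y 0 i - z 0 i) ^+ 2).
Proof.
rewrite /eht_Q mulr0 !mul0r add0r big_split/=.
rewrite !(mulrAC _ (_^-1)) -mulrDl l0_penaltyE mulr_suml sqr_norm2 mulr_sumr.
by congr (_ + _); apply: eq_bigr => i _; rewrite !mxE.
Qed.

End Penalty.

(** * Summability and subsequences *)

Section RealSequences.
Context (R : realType).

Lemma telescope_le (E a b : nat -> R) :
  (forall k, E k.+1 + a k <= E k + b k) -> forall N,
  E N + \sum_(k < N) a k <= E 0%N + \sum_(k < N) b k.
Proof.
move=> Eab; elim=> [|N IHN]; first by rewrite !big_ord0.
by rewrite !big_ord_recr/=; have := Eab N; lra.
Qed.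

Lemma nneseries_bounded (a : nat -> R) (C : R) : (forall k, 0 <= a k) ->
  (forall N, \sum_(k < N) a k <= C) -> (\sum_(0 <= k <oo) (a k)%:E < +oo)%E.
Proof.
move=> a0 aC; apply: (@le_lt_trans _ _ C%:E); last exact: ltry.
apply: lime_le; first by apply: is_cvg_nneseries => k _ _; rewrite lee_fin.
by near=> N; rewrite sumEFin lee_fin big_mkord.
Unshelve. all: by end_near. Qed.

Lemma nneseries_partial_le (a : nat -> R) : (forall k, 0 <= a k) ->
  (\sum_(0 <= k <oo) (a k)%:E < +oo)%E ->
  exists C : R, forall N, \sum_(k < N) a k <= C.
Proof.
move=> a0 aoo; exists (fine (\sum_(0 <= k <oo) (a k)%:E)%E) => N.
have S0 : (0 <= \sum_(0 <= k <oo) (a k)%:E)%E.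
  by apply: nneseries_ge0 => k _ _; rewrite lee_fin.
rewrite -lee_fin fineK; last by rewrite ge0_fin_numE.
rewrite -(big_mkord xpredT a) -sumEFin.
by apply: nneseries_lim_ge => k _ _; rewrite lee_fin.
Qed.

Lemma summable_sqr_cvg0 (a : nat -> R) : (forall k, 0 <= a k) ->
  (\sum_(0 <= k <oo) (a k ^+ 2)%:E < +oo)%E -> a @ \oo --> 0.
Proof.
move=> a0 aoo; have sq := cvg_series_cvg_0
  (nnseries_is_cvg (fun k => sqr_ge0 (a k)) aoo).
have -> : a = Num.sqrt \o (fun k => a k ^+ 2).
  by apply/funext => k /=; rewrite sqrtr_sqr ger0_norm.
rewrite -[X in _ --> X](sqrtr0 R); apply: continuous_cvg => //.
exact: sqrt_continuous.
Qed.

Lemma increasing_seq_cvgny (s : nat -> nat) : increasing_seq s ->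
  s @ \oo --> \oo.
Proof.
move=> s_incr P [N _ PN]; exists N => // j /= Nj; apply: PN => /=.
apply: (leq_trans Nj); elim: j {Nj} => // j IHj; apply: (leq_ltn_trans IHj).
by have := increasing_seqP s; move=> [_ /(_ s_incr j)].
Qed.

End RealSequences.

(** * Energy decrease along the iterates *)

Section Algorithm.
Context (R : realType) (n : nat) (f : 'rV[R]_n -> R) (Lf : R)
  (l u : 'I_n -> \bar R) (lambda1 lambda2 beta h gamma : R)
  (e x : nat -> 'rV[R]_n).
Hypotheses (lambda1_gt0 : 0 < lambda1) (lambda2_ge0 : 0 <= lambda2).
Hypotheses (h_gt0 : 0 < h) (gamma_gt0 : 0 < gamma).
Hypothesis x_generated : perturbed_eht f l u lambda1 lambda2 0 beta h gamma e x.

Local Notation phi := (sign_cost lambda1 lambda2).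
Local Notation F := (objective f lambda1 lambda2).
Local Notation A := (h ^- 2 + gamma / h).

(** This vector is - (1 + h gamma) / h times z^k: the linear coefficient in
    w - x^k of the subproblem, once multiplied by 1 + h gamma and rewritten in
    the variable w = x^k + h y. *)
Definition eht_slope (k : nat) : 'rV[R]_n :=
  gradient f (x k) - e k
  + (beta / h) *: (gradient f (x k) - gradient f (x k.-1))
  - h ^- 2 *: (x k - x k.-1).

Lemma eht_box k : box l u (x k).
Proof.
have [x0 xS] := x_generated; case: k => // k.
by have [y [/(step_boxP l u _ _ h_gt0) yB _] <-] := xS k.
Qed.

(** Replacing the i-th coordinate of the minimizer y by (b - x^k_i) / h stays
    in the box and changes only the i-th term of the subproblem. *)
Lemma eht_coord_min k i b : (l i <= b%:E <= u i)%E ->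
  phi (x k.+1 0 i) + A / 2 * (x k.+1 0 i - x k 0 i) ^+ 2
    + (x k.+1 0 i - x k 0 i) * eht_slope k 0 i
  <= phi b + A / 2 * (b - x k 0 i) ^+ 2 + (b - x k 0 i) * eht_slope k 0 i.
Proof.
move=> lbu; have [_ /(_ k)[y ymin yE]] := x_generated.
set z := eht_z f beta h gamma e x k in ymin.
have c0 : 0 < 1 + h * gamma by rewrite addr_gt0// mulr_gt0.
pose g j t := phi (x k 0 j + h * t) / (1 + h * gamma)
  + 2^-1 * (t - z 0 j) ^+ 2.
have ymin' : argmin_set (step_box l u h (x k))
    (fun y => \sum_(i < n) g i (y 0 i)) y.
  rewrite (_ : (fun _ => _) = eht_Q lambda1 lambda2 0 h gamma (x k) z)//.
  by apply/funext => w; rewrite eht_QE.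
have := @separable_argmin _ _ _ g y i ((b - x k 0 i) / h) ymin'.
have bE : x k 0 i + h * ((b - x k 0 i) / h) = b.
  by field; rewrite gt_eqF.
have xSE : x k.+1 0 i = x k 0 i + h * y 0 i by rewrite -yE !mxE.
have wB : step_box l u h (x k)
    (\row_j if j == i then (b - x k 0 i) / h else y 0 j).
  apply/(step_boxP l u _ _ h_gt0) => j; rewrite !mxE; case: eqVneq => [->|_].
    by rewrite bE.
  by have := eht_box k.+1 j; rewrite -yE !mxE.
move=> /(_ wB); rewrite /g bE -xSE => gle.
(* The gap between the two sides is 1 + h gamma times the gap in gle: the
   squares of z cancel. *)
rewrite -subr_ge0; move: gle; rewrite -subr_ge0 -(pmulr_rge0 _ c0) => /le_trans.
apply; rewrite le_eqVlt; apply/orP; left; apply/eqP.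
have -> : y 0 i = (x k.+1 0 i - x k 0 i) / h.
  by rewrite xSE; field; rewrite gt_eqF.
rewrite /z /eht_z /eht_v /eht_slope !mxE.
by field; rewrite !gt_eqF.
Qed.

Lemma eht_penalty_step k :
  \sum_(i < n) phi (x k.+1 0 i) + A / 2 * norm2 (x k.+1 - x k) ^+ 2
    + dot (x k.+1 - x k) (eht_slope k)
  <= \sum_(i < n) phi (x k 0 i).
Proof.
rewrite sqr_norm2 mulr_sumr -!big_split/=; apply: ler_sum => i _.
have := eht_coord_min k (eht_box k i).
rewrite subrr expr0n mulr0 mul0r !addr0; apply: le_trans.
by rewrite !mxE.
Qed.

Hypotheses (f_smooth : lipschitz_gradient f Lf) (Lf_ge0 : 0 <= Lf).
Hypotheses (beta_ge0 : 0 <= beta)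
  (gamma_large : h^-1 + (2 * beta + h) * Lf < gamma).

(** F alone need not decrease, since the extrapolation can move uphill; the
    multiple of the last squared step is what that move can cost. *)
Definition eht_energy (k : nat) : R :=
  F (x k) + (beta * Lf / h + h ^- 2) / 2 * norm2 (x k - x k.-1) ^+ 2.

(** The excess of the coefficient of |x^(k+1) - x^k|^2 over that of
    |x^k - x^(k-1)|^2 in the energy estimate.  Half of it absorbs the error
    term, the other half is the guaranteed decrease. *)
Definition eht_margin : R := (gamma - (h^-1 + (2 * beta + h) * Lf)) / (2 * h).

Lemma eht_margin_gt0 : 0 < eht_margin.
Proof. by rewrite divr_gt0 ?mulr_gt0// subr_gt0. Qed.

Lemma eht_energy_step k :
  eht_energy k.+1 + eht_margin / 2 * norm2 (x k.+1 - x k) ^+ 2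
  <= eht_energy k + norm2 (e k) ^+ 2 / (2 * eht_margin).
Proof.
have pen := eht_penalty_step k.
have des := lipschitz_gradient_le_quadratic (x k) (x k.+1) f_smooth.
set d := x k.+1 - x k in pen des *; set d' := x k - x k.-1.
rewrite dotC in des.
set g := gradient f (x k) in des *.
set dg := g - gradient f (x k.-1).
have slopeE : dot d (eht_slope k) =
    dot d g - dot d (e k) + beta / h * dot d dg - h ^- 2 * dot d d'.
  by rewrite /eht_slope !(dotDr, dotNr, dotZr) -/g.
(* The error is split with weight the margin, the two differences
   with equal weights. *)
have le_e := young_dot d (e k) eht_margin_gt0.
have le_dd : dot d d' <= (norm2 d ^+ 2 + norm2 d' ^+ 2) / 2.
  by have := young_dot d d' ltr01; lra.
have le_dg : - dot d dg <= Lf / 2 * (norm2 d ^+ 2 + norm2 d' ^+ 2).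
  rewrite -dotNr; apply: (le_trans (dot_le_norm2 _ _)); rewrite norm2N.
  apply: (@le_trans _ _ (norm2 d * (Lf * norm2 d'))).
    by rewrite ler_wpM2l ?norm2_ge0// f_smooth.2.
  have := mulr_ge0 Lf_ge0 (sqr_ge0 (norm2 d - norm2 d')); lra.
have h2_ge0 : 0 <= h ^- 2 by rewrite invr_ge0 exprn_ge0// ltW.
have {}le_dd := ler_wpM2l h2_ge0 le_dd.
have {}le_dg := ler_wpM2l (divr_ge0 beta_ge0 (ltW h_gt0)) le_dg.
rewrite /eht_energy !objectiveE/= -/d -/d'.
rewrite slopeE in pen.
set nd := norm2 d ^+ 2 in pen des le_e le_dd le_dg *.
set nd' := norm2 d' ^+ 2 in pen des le_e le_dd le_dg *.
have marginE : (beta * Lf / h + h ^- 2) / 2 * nd + eht_margin / 2 * nd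
    + eht_margin / 2 * nd + Lf / 2 * nd =
    A / 2 * nd - h ^- 2 / 2 * nd - beta / h * (Lf / 2 * nd).
  by rewrite /eht_margin; field; rewrite gt_eqF.
lra.
Qed.

Hypothesis e_summable : (\sum_(0 <= k <oo) (norm2 (e k) ^+ 2)%:E < +oo)%E.

(** A lower bound of F along infinitely many iterates suffices because the
    partial sums of the squared steps increase with their number of terms. *)
Lemma eht_steps_summable (M : R) :
  (forall N, exists2 k, (N <= k)%N & M <= F (x k)) ->
  (\sum_(0 <= k <oo) (norm2 (x k.+1 - x k) ^+ 2)%:E < +oo)%E.
Proof.
move=> FM; have k0 := eht_margin_gt0.
have [C eC] := nneseries_partial_le (fun k => sqr_ge0 (norm2 (e k))) e_summable.
pose a k := eht_margin / 2 * norm2 (x k.+1 - x k) ^+ 2.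
have a0 k : 0 <= a k by rewrite mulr_ge0 ?sqr_ge0// divr_ge0// ltW.
pose D := eht_energy 0 + C / (2 * eht_margin) - M.
apply: (@nneseries_bounded _ _ (D / (eht_margin / 2))) => [k|N].
  exact: sqr_ge0.
have m0 : 0 < eht_margin / 2 by rewrite divr_gt0.
rewrite (ler_pdivlMr _ _ m0) mulr_suml.
rewrite (eq_bigr (fun k : 'I_N => a k)); last by move=> j _; rewrite mulrC.
have [k Nk Mk] := FM N.
have aNk : \sum_(j < N) a j <= \sum_(j < k) a j.
  rewrite -!(big_mkord xpredT a) (big_cat_nat (leq0n N) Nk)//= lerDl.
  by rewrite sumr_ge0.
have := telescope_le eht_energy_step k; rewrite -mulr_suml => tele.
have eCk : (\sum_(j < k) norm2 (e j) ^+ 2) / (2 * eht_margin)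
    <= C / (2 * eht_margin).
  by rewrite ler_pM2r ?eC// invr_gt0 mulr_gt0.
have Ek : M <= eht_energy k.
  apply: (le_trans Mk); rewrite lerDl mulr_ge0 ?sqr_ge0// divr_ge0//.
  by rewrite addr_ge0 ?divr_ge0 ?mulr_ge0 ?invr_ge0 ?exprn_ge0// ltW.
by apply: (le_trans aNk); rewrite /D; move: tele; rewrite -/(a _); lra.
Qed.

(** * Limit points are local minimizers *)

Section LimitPoint.
Variables (s : nat -> nat) (xs : 'rV[R]_n).
Hypotheses (s_incr : increasing_seq s) (x_xs : x \o s @ \oo --> xs).

(** A convergent subsequence replaces a lower bound of F on the whole box in
    [eht_steps_summable]: f is continuous and the penalty nonnegative. *)
Lemma eht_lower_bound_at_limit N :
  exists2 k, (N <= k)%N & f xs - 1 <= F (x k).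
Proof.
have fx : f (x (s j)) @[j --> \oo] --> f xs.
  apply: (@continuous_cvg _ _ _ _ _ _ f) => //.
  by apply: differentiable_continuous; exact: f_smooth.1.
have [j [Nj fj]] : exists j, (N <= s j)%N /\ f xs - 1 <= f (x (s j)).
  apply: (@filter_ex _ \oo); near=> j; split; near: j.
    exact: (increasing_seq_cvgny s_incr (nbhs_infty_ge N)).
  by apply: (cvgr_ge _ fx); rewrite gtrBl.
exists (s j) => //; apply: (le_trans fj); rewrite objectiveE lerDl.
by apply: sumr_ge0 => i _; exact: sign_cost_ge0.
Unshelve. all: by end_near. Qed.

Hypothesis steps_summable :
  (\sum_(0 <= k <oo) (norm2 (x k.+1 - x k) ^+ 2)%:E < +oo)%E.

(** Every other term of the slope vanishes: e^k and x^k - x^(k-1) are square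
    summable, and the gradient is Lipschitz. *)
Lemma eht_slope_cvg i : eht_slope (s j) 0 i @[j --> \oo] --> gradient f xs 0 i.
Proof.
have s_oo := increasing_seq_cvgny s_incr.
have [fdiff flip] := f_smooth.
have step0 : norm2 (x k - x k.-1) @[k --> \oo] --> 0.
  rewrite -cvg_shiftS/=.
  exact: (summable_sqr_cvg0 (fun k => norm2_ge0 (x k.+1 - x k)) steps_summable).
have e0 := summable_sqr_cvg0 (fun k => norm2_ge0 (e k)) e_summable.
have lip0 (y z : nat -> 'rV[R]_n) : norm2 (y k - z k) @[k --> \oo] --> 0 ->
    norm2 (gradient f (y k) - gradient f (z k)) @[k --> \oo] --> 0.
  move=> yz.
  apply: (@squeeze_cvgr _ _ _ _ (fun=> 0) (fun k => Lf * norm2 (y k - z k))).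
  - by near=> k; rewrite norm2_ge0 flip.
  - exact: cvg_cst.
  - by rewrite -[X in _ --> X](mulr0 Lf); apply: cvgM => //; exact: cvg_cst.
have g_cvg : gradient f (x (s j)) 0 i @[j --> \oo] --> gradient f xs 0 i.
  exact: cvg_coord_norm2 (lip0 _ (fun=> xs) (cvg_norm2_sub x_xs)).
have sub_cvg (v : nat -> 'rV[R]_n) : norm2 (v k) @[k --> \oo] --> 0 ->
    v (s j) 0 i @[j --> \oo] --> 0.
  by move=> v0; apply: cvg_coord_norm2_0; exact: cvg_comp s_oo v0.
pose dx k := x k - x k.-1; pose dg k := gradient f (x k) - gradient f (x k.-1).
have -> : (fun j => eht_slope (s j) 0 i) = (fun j => gradient f (x (s j)) 0 i
    - e (s j) 0 i + beta / h * dg (s j) 0 i - h ^- 2 * dx (s j) 0 i).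
  by apply/funext => j; rewrite /eht_slope /dg /dx !mxE.
have -> : gradient f xs 0 i = gradient f xs 0 i - 0 + beta / h * 0 - h ^- 2 * 0.
  by rewrite !mulr0 !subr0 addr0.
apply: cvgB; [apply: cvgD; [exact: cvgB (sub_cvg _ e0)|]|].
- apply: cvgM; [exact: cvg_cst|apply: sub_cvg].
  exact: (lip0 _ (fun k => x k.-1) step0).
- by apply: cvgM; [exact: cvg_cst|exact: sub_cvg step0].
Unshelve. all: by end_near. Qed.

(** On the left-hand side the penalty of the iterates is replaced by its value
    at the limit point, which is eventually no larger by lower semicontinuity;
    all other terms converge. *)
Lemma eht_limit_coord_min i b : (l i <= b%:E <= u i)%E ->
  phi (xs 0 i) <= phi b + A / 2 * (b - xs 0 i) ^+ 2
    + (b - xs 0 i) * gradient f xs 0 i.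
Proof.
move=> lbu; have s_oo := increasing_seq_cvgny s_incr.
set z := xs 0 i; set g := gradient f xs 0 i.
pose a j := x (s j) 0 i; pose a' j := x (s j).+1 0 i.
pose q j := eht_slope (s j) 0 i.
have a_z : a @ \oo --> z by apply: cvg_coord_norm2; exact: cvg_norm2_sub x_xs.
have a'_z : a' @ \oo --> z.
  have step0 : norm2 (x (s j).+1 - x (s j)) @[j --> \oo] --> 0.
    exact: cvg_comp s_oo
      (summable_sqr_cvg0 (fun k => norm2_ge0 (x k.+1 - x k)) steps_summable).
  have -> : a' = (fun j => a j + (x (s j).+1 - x (s j)) 0 i).
    by apply/funext => j; rewrite /a /a' !mxE addrCA subrr addr0.
  rewrite -[z]addr0; apply: cvgD => //; exact: cvg_coord_norm2_0.
have q_g : q @ \oo --> g by exact: eht_slope_cvg.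
pose lhs j :=
  phi z + A / 2 * ((a' j - a j) * (a' j - a j)) + (a' j - a j) * q j.
pose rhs j := phi b + A / 2 * ((b - a j) * (b - a j)) + (b - a j) * q j.
have lhs_cvg : lhs @ \oo --> phi z + A / 2 * ((z - z) * (z - z)) + (z - z) * g.
  by do ![exact: cvg_cst|done|apply: cvgB|apply: cvgD|apply: cvgM].
have rhs_cvg : rhs @ \oo --> phi b + A / 2 * ((b - z) * (b - z)) + (b - z) * g.
  by do ![exact: cvg_cst|done|apply: cvgB|apply: cvgD|apply: cvgM].
have : phi z + A / 2 * ((z - z) * (z - z)) + (z - z) * g <=
    phi b + A / 2 * ((b - z) * (b - z)) + (b - z) * g.
  apply: (ler_cvg_to lhs_cvg rhs_cvg).
  have lsc := a'_z _ (sign_cost_lsc lambda1_gt0 lambda2_ge0 z).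
  near=> j; have := eht_coord_min (s j) lbu.
  rewrite -/(a j) -/(a' j) -/(q j) /lhs /rhs !expr2.
  have : phi z <= phi (a' j) by near: j.
  by lra.
by rewrite subrr mulr0 mul0r mulr0 !addr0 expr2.
Unshelve. all: by end_near. Qed.

Hypothesis xs_box : box l u xs.

Lemma eht_limit_local_min : convex_function setT f ->
  local_minimizer F (box l u) xs.
Proof.
move=> f_convex; split => //.
have /choice[delta deltaP] : forall i, exists delta : R, 0 < delta /\
    forall b : R, (l i <= b%:E <= u i)%E -> `|b - xs 0 i| <= delta ->
    phi (xs 0 i) <= phi b + (b - xs 0 i) * gradient f xs 0 i.
  move=> i; have [d d0 dP] := sign_cost_local_min lambda1_gt0 lambda2_ge0
    (xs_box i) (@eht_limit_coord_min i).
  by exists d.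
(* The default value 1 keeps the radius positive in dimension 0. *)
exists (\big[Num.min/1]_(i < n) delta i).
  by apply/bigmin_gtP; split => // i _; have [] := deltaP i.
move=> w wB w_near; have [fdiff _] := f_smooth.
rewrite !objectiveE.
apply: le_trans (lerD (convex_ge_tangent w f_convex (fdiff xs)) (lexx _)).
rewrite -addrA lerD2l -big_split/=; apply: ler_sum => i _.
have [_ /(_ (w 0 i) (wB i))] := deltaP i.
rewrite !mxE => H; rewrite addrC mulrC; apply: H.
have := coord_le_norm2 (w - xs) i; rewrite !mxE => /le_trans; apply.
by apply: (le_trans w_near); exact: bigmin_le.
Qed.

End LimitPoint.
End Algorithm.

Theorem theorem5p2 (R : realType) (n : nat) (f : 'rV[R]_n -> R) (Lf : R)
    (l u : 'I_n -> \bar R) (lambda1 lambda2 beta h gamma : R)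
    (e x : nat -> 'rV[R]_n)
    (f_convex : convex_function setT f)
    (f_smooth : lipschitz_gradient f Lf)
    (lambda1_gt0 : 0 < lambda1) (lambda2_ge0 : 0 <= lambda2)
    (l_le0 : forall i, (l i <= 0)%E) (u_ge0 : forall i, (0 <= u i)%E)
    (l_lt_u : forall i, (l i < u i)%E)
    (beta_ge0 : 0 <= beta) (h_gt0 : 0 < h) (gamma_gt0 : 0 < gamma)
    (gamma_large : h^-1 + (2 * beta + h) * Lf < gamma)
    (x_generated : perturbed_eht f l u lambda1 lambda2 0 beta h gamma e x)
    (e_summable : (\sum_(0 <= k <oo) (norm2 (e k) ^+ 2)%:E < +oo)%E) :
  (* without this bound the sum can diverge: f x = - x on the real line *)
  (has_lbound (objective f lambda1 lambda2 @` box l u) ->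
     (\sum_(0 <= k <oo) (norm2 (x k.+1 - x k) ^+ 2)%:E < +oo)%E) /\
  (forall xs, subseq_limits (box l u) x xs ->
     local_minimizer (objective f lambda1 lambda2) (box l u) xs).
Proof.
have [Lf_ge0|Lf_lt0] := leP 0 Lf; last first.
  (* A negative Lipschitz constant forces the space to be a single point. *)
  have trivial_space (y z : 'rV[R]_n) : norm2 (y - z) = 0.
    apply/le_anti; rewrite norm2_ge0 andbT -(nmulr_rge0 _ Lf_lt0).
    by apply: le_trans (norm2_ge0 _) (f_smooth.2 y z).
  split=> [_|xs [xs_box _]].
    apply: (@nneseries_bounded _ _ 0) => [k|N]; first exact: sqr_ge0.
    by rewrite big1// => k _; rewrite trivial_space expr0n.
  split=> //; exists 1 => // y _ _.
  by have /eqP := norm2_eq0 (trivial_space y xs); rewrite subr_eq0 => /eqP ->.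
have summable := eht_steps_summable h_gt0 gamma_gt0
  x_generated f_smooth Lf_ge0 beta_ge0 gamma_large e_summable.
split=> [[M FM]|xs [xs_box [s s_incr x_xs]]].
  apply: (summable M) => N; exists N => //.
  by apply: FM; exists (x N) => //; exact: (eht_box h_gt0 x_generated).
have steps := summable _
  (eht_lower_bound_at_limit lambda1_gt0 lambda2_ge0 f_smooth s_incr x_xs).
exact: (eht_limit_local_min lambda1_gt0 lambda2_ge0 h_gt0 gamma_gt0 x_generated
  f_smooth e_summable s_incr x_xs steps xs_box f_convex).
Qed.
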